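(* Let $A,B$ be commutative rings, $f:A\to B$ a ring homomorphism and $J$ an ideal of $B$ (an $A$-module via $f$). (1) Let $\mathcal A$ be a nonempty class of ideals of $A$ and assume $f$ satisfies the going-down property. If the ring $A\bowtie^fJ$ is Cohen–Macaulay in the sense of $\mathcal A^e:=\{\mathfrak a^e:\mathfrak a\in\mathcal A\}$, then $A$ is Cohen–Macaulay in the sense of $\mathcal A$ and $\operatorname{Kgrade}_A(\mathfrak a,J)\ge\operatorname{ht}\mathfrak a$ for every $\mathfrak a\in\mathcal A$. (2) Assume that $\iota_A:A\to A\bowtie^fJ$ is an integral ring extension. If $A$ is Cohen–Macaulay in the sense of ideals and $\operatorname{Kgrade}_A(\mathfrak a,J)\ge\operatorname{ht}\mathfrak a$ for every ideal $\mathfrak a$ of $A$, then $A\bowtie^fJ$ is Cohen–Macaulay in the sense of ideals.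
   Context: $A\bowtie^fJ=\{(a,f(a)+j): a\in A,\ j\in J\}\subseteq A\times B$; $\iota_A:A\to A\bowtie^fJ$, $\iota_A(x)=(x,f(x))$; $\mathfrak a^e=\iota_A(\mathfrak a)(A\bowtie^fJ)$. Koszul grade: for a ring $R$, an $R$-module $M$ and a finitely generated ideal $\mathfrak b=(x_1,\dots,x_\ell)$, $\operatorname{Kgrade}_R(\mathfrak b,M)=\inf\{i\ge0: H^i(\operatorname{Hom}_R(\mathbb K_\bullet(x_1,\dots,x_\ell),M))\ne0\}$ ($\inf\emptyset=\infty$), independent of generators; for arbitrary $\mathfrak a$, the sup over finitely generated subideals. $\operatorname{ht}I=\inf\{\dim R_\mathfrak P:\mathfrak P\supseteq I$ prime$\}$. For a nonempty class $\mathcal C$ of ideals of $R$, $R$ is Cohen–Macaulay in the sense of $\mathcal C$ if $\operatorname{ht}I=\operatorname{Kgrade}_R(I,R)$ for all $I\in\mathcal C$; ''in the sense of ideals'' means for the class of all ideals. *)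

(* Defs.v *)
From HB Require Import structures.
From mathcomp Require Import all_boot all_algebra.
From mathcomp Require Import boolp ring.
From Stdlib Require Import ClassicalEpsilon.

Set Implicit Arguments.
Unset Strict Implicit.
Unset Printing Implicit Defensive.

Import GRing.Theory.
Local Open Scope ring_scope.

Inductive enat := Fin of nat | Inf.

Definition ele (x y : enat) : Prop :=
  match x, y with
  | _, Inf => True
  | Inf, Fin _ => False
  | Fin m, Fin n => (m <= n)%N
  end.

Definition is_elub (S : enat -> Prop) (s : enat) : Prop :=
  (forall x, S x -> ele x s) /\ (forall u, (forall x, S x -> ele x u) -> ele s u).
Definition is_eglb (S : enat -> Prop) (s : enat) : Prop :=
  (forall x, S x -> ele s x) /\ (forall u, (forall x, S x -> ele u x) -> ele u s).

(* sup and inf in the complete lattice N ∪ {∞} (inf ∅ = ∞, sup ∅ = 0) *)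
Definition esup (S : enat -> Prop) : enat := epsilon (inhabits Inf) (is_elub S).
Definition einf (S : enat -> Prop) : enat := epsilon (inhabits Inf) (is_eglb S).

Section RingNotions.
Variable R : comNzRingType.

Definition is_ideal (I : R -> Prop) : Prop :=
  [/\ I 0, (forall x y, I x -> I y -> I (x + y)) & (forall r x, I x -> I (r * x))].

Definition is_prime (P : R -> Prop) : Prop :=
  [/\ is_ideal P, ~ P 1 & (forall x y, P (x * y) -> P x \/ P y)].

Definition psubset (I K : R -> Prop) : Prop :=
  (forall x, I x -> K x) /\ (exists x, K x /\ ~ I x).

Definition prime_chain_in (P : R -> Prop) (n : nat) : Prop :=
  exists c : nat -> R -> Prop,
    [/\ (forall k, (k <= n)%N -> is_prime (c k)),
        (forall k, (k < n)%N -> psubset (c k) (c k.+1)) &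
        (forall x, c n x -> P x)].

(* dim R_P = Krull dimension of the localization = sup of lengths of chains
   of primes of R contained in P *)
Definition dim_loc (P : R -> Prop) : enat :=
  esup (fun e => exists n, e = Fin n /\ prime_chain_in P n).

Definition height (I : R -> Prop) : enat :=
  einf (fun e => exists P, [/\ is_prime P, (forall x, I x -> P x) & e = dim_loc P]).

(* Coefficients: an R-module given as a submodule M (predicate) of a
   zmodType V with scalar action act. Hom_R(K_i(x), M) is identified with
   functions from the i-subsets S of {0..l-1} to M (values at e_S). *)
Variables (V : zmodType) (act : R -> V -> V) (M : V -> Prop).

(* (d phi)(S) = phi(∂ e_S) = sum_{j in S} (-1)^{#{k in S | k < j}} x_j phi(S \ j) *)
Definition koszul_d (l : nat) (x : 'I_l -> R) (phi : {set 'I_l} -> V)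
    (S : {set 'I_l}) : V :=
  \sum_(j in S) act ((-1) ^+ #|[set k in S | (k < j)%N]| * x j) (phi (S :\ j)).

Definition kcochain (l i : nat) (phi : {set 'I_l} -> V) : Prop :=
  forall S : {set 'I_l}, #|S| = i -> M (phi S).

Definition kcocycle (l : nat) (x : 'I_l -> R) (i : nat) (phi : {set 'I_l} -> V) : Prop :=
  forall S : {set 'I_l}, #|S| = i.+1 -> koszul_d x phi S = 0.

Definition kcoboundary (l : nat) (x : 'I_l -> R) (i : nat) (phi : {set 'I_l} -> V) : Prop :=
  match i with
  | 0 => forall S : {set 'I_l}, #|S| = 0%N -> phi S = 0
  | i'.+1 => exists psi, kcochain i' psi /\
               forall S : {set 'I_l}, #|S| = i'.+1 -> koszul_d x psi S = phi S
  end.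

Definition koszul_H_nonzero (l : nat) (x : 'I_l -> R) (i : nat) : Prop :=
  exists phi, [/\ kcochain i phi, kcocycle x i phi & ~ kcoboundary x i phi].

Definition kgrade_gens (l : nat) (x : 'I_l -> R) : enat :=
  einf (fun e => exists i, e = Fin i /\ koszul_H_nonzero x i).

Definition kgrade (a : R -> Prop) : enat :=
  esup (fun e => exists l (x : 'I_l -> R), (forall j, a (x j)) /\ e = kgrade_gens x).

End RingNotions.

Definition kgrade_self (R : comNzRingType) (a : R -> Prop) : enat :=
  @kgrade R R ( *%R) (fun _ => True) a.

Definition CM_in (R : comNzRingType) (C : (R -> Prop) -> Prop) : Prop :=
  forall I, C I -> height I = kgrade_self I.

Definition going_down (A B : comNzRingType) (f : A -> B) : Prop :=
  forall p p' : A -> Prop, is_prime p -> is_prime p' -> (forall x, p' x -> p x) ->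
  forall Q : B -> Prop, is_prime Q -> (forall x, Q (f x) <-> p x) ->
  exists Q' : B -> Prop, [/\ is_prime Q', (forall y, Q' y -> Q y) &
                             (forall x, Q' (f x) <-> p' x)].

Record ideal (R : comNzRingType) := Ideal {
  ideal_mem :> R -> Prop;
  ideal_isI : is_ideal ideal_mem }.

Section Dup.
Variables (A B : comNzRingType) (f : {rmorphism A -> B}) (J : ideal B).

Definition dup_pred : pred (A * B) := fun p => `[< J (p.2 - f p.1) >].

Lemma ideal_sub (x y : B) : J x -> J y -> J (x - y).
Proof.
case: (ideal_isI J) => _ hD hM Jx Jy.
by apply: hD => //; rewrite -mulN1r; apply: hM.
Qed.

Lemma dup_subring_closed : subring_closed dup_pred.
Proof.
case: (ideal_isI J) => J0 hD hM.
split.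
- by apply/asboolP; rewrite /= rmorph1 subrr.
- move=> [a b] [a' b'] /asboolP /= h /asboolP /= h'; apply/asboolP => /=.
  rewrite rmorphB /= (_ : _ - _ = (b - f a) - (b' - f a')); last by ring.
  exact: ideal_sub.
- move=> [a b] [a' b'] /asboolP /= h /asboolP /= h'; apply/asboolP => /=.
  rewrite rmorphM /= (_ : _ - _ = b * (b' - f a') + f a' * (b - f a)); last first.
    by ring.
  by apply: hD; apply: hM.
Qed.

HB.instance Definition _ := GRing.isSubringClosed.Build (A * B)%type dup_pred
  dup_subring_closed.

Definition dup : Type := {p : (A * B)%type | p \in dup_pred}.
HB.instance Definition _ := [isSub for (@sval _ (fun p => p \in dup_pred) : dup -> _)].
HB.instance Definition _ := [Choice of dup by <:].
HB.instance Definition _ := [SubChoice_isSubComNzRing of dup by <:].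

Lemma iota_subproof (x : A) : (x, f x) \in dup_pred.
Proof. by apply/asboolP; rewrite /= subrr; case: (ideal_isI J). Qed.

Definition iota (x : A) : dup := exist _ (x, f x) (iota_subproof x).

Definition ext (a : A -> Prop) (z : dup) : Prop :=
  exists n (r : 'I_n -> dup) (y : 'I_n -> A),
    (forall k, a (y k)) /\ z = \sum_(k < n) r k * iota (y k).

Definition iota_integral_ext : Prop :=
  injective iota /\
  forall z : dup, exists p : {poly A}, p \is monic /\ root (map_poly iota p) z.

Definition kgrade_J (a : A -> Prop) : enat :=
  @kgrade A B (fun r v => f r * v) J a.

End Dup.

Arguments dup {A B} f J.
Arguments iota {A B} f J x.
Arguments ext {A B} f J a z.
Arguments iota_integral_ext {A B} f J.
Arguments kgrade_J {A B} f J a.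
Arguments going_down {A B} f.

(* Main.v *)
Require Import Defs.
From HB Require Import structures.
From mathcomp Require Import all_boot all_algebra.
From mathcomp Require Import boolp ring.
From mathcomp Require classical_sets.
From Stdlib Require Import ClassicalEpsilon.

(* As an A-module the amalgamation is A (+) J, so the Koszul complex of iota(x)
   on it is the sum of those of x on A and on J, and the Koszul grade of an
   extended ideal is the minimum of the grades on A and on J.  Grades never
   exceed heights.  In (1), iota inherits going-down from f, whence
   ht a <= ht a^e = Kgrade(a^e) <= Kgrade(a, A) <= ht a.  In (2), with a the
   contraction of I, lying over and incomparability give
   ht I <= ht a <= min (Kgrade(a, A), Kgrade(a, J)) <= Kgrade(I) <= ht I.

   The inequality Kgrade(x, R) <= dim R_P for x inside a prime P rests on
   Kronecker's theorem: if dim R_P <= n then locally at P the ideal (x) is, up to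
   radical, contained in one generated by n elements y of P.  If the cohomology of
   K(x) vanished in degrees <= n, so would that of K(x, y); since s z^N is
   null-homotopic on K(y) for each z in x and some s outside P, the elements of x
   can be removed one by one, at the price of multiplying by elements outside P.
   Hence some t outside P kills H^n(y; R) = R / (y), contradicting (y) <= P. *)

Set Implicit Arguments.
Unset Strict Implicit.
Unset Printing Implicit Defensive.

Import GRing.Theory.
Local Open Scope ring_scope.

(** * Extended naturals and primes *)

Lemma ele_refl x : ele x x.
Proof. by case: x => /=. Qed.

Lemma ele_trans y x z : ele x y -> ele y z -> ele x z.
Proof. by case: x y z => [x|] [y|] [z|] //=; apply: leq_trans. Qed.

Lemma ele_anti x y : ele x y -> ele y x -> x = y.
Proof.
by case: x y => [x|] [y|] //= h h'; congr Fin; apply/eqP; rewrite eqn_leq h.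
Qed.

(** Positive finite bounds are the ones that grades understand: [Fin n.+1] below a grade means
    vanishing in degrees up to [n]. *)
Lemma ele_of_Fin x y :
  (forall n, ele (Fin n.+1) x -> ele (Fin n.+1) y) -> ele x y.
Proof.
case: x y => [[|m]|] [y|] //= h; first exact: h.
by have := h y I; rewrite ltnn.
Qed.

Lemma not_ele_Fin n x : ~ ele (Fin n.+1) x -> ele x (Fin n).
Proof. by case: x => [m|] //= /negP; rewrite -leqNgt. Qed.

Lemma eglb_exists S : exists s, is_eglb S s.
Proof.
case: (pselect (exists n, S (Fin n))) => [[n0 Sn0]|noS].
  have ex : exists n, `[< S (Fin n) >] by exists n0; apply/asboolP.
  case: (ex_minnP ex) => m /asboolP Sm mmin; exists (Fin m); split.
    by move=> [n|] //= Sn; apply/mmin/asboolP.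
  by move=> u; apply.
exists Inf; split; last by case.
by move=> [n|] // Sn; case: noS; exists n.
Qed.

Lemma einfP S : is_eglb S (einf S).
Proof. exact: epsilon_spec (eglb_exists S). Qed.

Lemma esupP S : is_elub S (esup S).
Proof.
apply: epsilon_spec.
have [s [sle sgl]] := eglb_exists (fun u => forall x, S x -> ele x u).
by exists s; split=> // x Sx; apply: sgl => u; apply.
Qed.

Lemma esup_Fin_lt S n :
  ele (Fin n.+1) (esup S) -> exists2 e, S e & ele (Fin n.+1) e.
Proof.
move=> h; apply: contrapT => noe.
have le_n : ele (esup S) (Fin n).
  apply: (proj2 (esupP S)) => x Sx; apply: not_ele_Fin => lt_x.
  by apply: noe; exists x.
by move: (ele_trans h le_n); rewrite /= ltnn.
Qed.

(** * Existence of primes and Kronecker's theorem at a prime *)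

Section Primes.
Variable R : comNzRingType.
Implicit Types I P Q S : R -> Prop.

Lemma is_ideal_zero : is_ideal (fun x : R => x = 0).
Proof.
by split=> // [x y -> ->|r x ->]; [rewrite addr0 | rewrite mulr0].
Qed.

Lemma idealN I x : is_ideal I -> I x -> I (- x).
Proof. by case=> _ _ hM Ix; rewrite -mulN1r; apply: hM. Qed.

Lemma idealB I x y : is_ideal I -> I x -> I y -> I (x - y).
Proof. by move=> hI Ix Iy; case: (hI) => _ hD _; apply: hD => //; apply: idealN. Qed.

Lemma idealBl I x y : is_ideal I -> I (x - y) -> I y -> I x.
Proof. by move=> hI Ixy Iy; rewrite -(subrK y x); case: hI => _ hD _; apply: hD. Qed.

Lemma primeX P x n : is_prime P -> P (x ^+ n) -> P x.
Proof.
case=> hI P1 hM; elim: n => [/P1//|n IH].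
by rewrite exprS => /hM[].
Qed.

(** Zorn gives an ideal maximal among those containing [I] and missing [S]. The last clause records
    maximality, which lying over exploits. *)
Lemma prime_disjoint I S : is_ideal I -> S 1 ->
    (forall x y, S x -> S y -> S (x * y)) -> (forall x, I x -> ~ S x) ->
  exists Q, [/\ is_prime Q, (forall x, I x -> Q x), (forall x, Q x -> ~ S x) &
    forall z, ~ Q z -> exists q r, Q q /\ S (q + r * z)].
Proof.
move=> hI S1 SM dis.
pose good (X : R -> Prop) := is_ideal X /\ forall x, X x -> ~ S x.
(* The empty chain has empty union, which is no ideal; adjoining [I] repairs this case. *)
pose ext0 (X : R -> Prop) : R -> Prop := fun x => X x \/ I x.
have := @classical_sets.Zorn_bigcup R (fun X => good (ext0 X)).
case.
  move=> F goodF tot.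
  case: (pselect (exists X, F X)) => [[X0 FX0]|noF]; last first.
    have E : ext0 (classical_sets.bigcup F id) = I.
      apply/funext => x; apply/propext; split; last by right.
      by case=> // -[X FX]; case: noF; exists X.
    by rewrite E.
  split; last first.
    move=> x [[X FX Xx]|Ix]; last exact: dis.
    by case: (goodF _ FX) => _; apply; left.
  have lift X Y x : (forall x, X x -> Y x) -> ext0 X x -> ext0 Y x.
    by move=> sXY [/sXY|]; [left|right].
  have wit x : ext0 (classical_sets.bigcup F id) x -> exists2 X, F X & ext0 X x.
    by case=> [[X FX Xx]|Ix]; [exists X => //; left | exists X0 => //; right].
  have unwit X x : F X -> ext0 X x -> ext0 (classical_sets.bigcup F id) x.
    by move=> FX [Xx|Ix]; [left; exists X | right].
  split.
  - by right; case: hI.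
  - move=> x y /wit[X FX Xx] /wit[Y FY Yy].
    have [sXY|sYX] := tot _ _ FX FY.
      apply: (unwit Y) => //; case: (goodF _ FY) => -[_ hD _] _.
      by apply: hD => //; apply: lift Xx.
    apply: (unwit X) => //; case: (goodF _ FX) => -[_ hD _] _.
    by apply: hD => //; apply: lift Yy.
  - move=> r x /wit[X FX Xx]; apply: (unwit X) => //.
    by case: (goodF _ FX) => -[_ _ hM] _; apply: hM.
move=> X [[hX disX] maxX]; set Q := ext0 X in hX disX.
have out z : ~ Q z -> exists q r, Q q /\ S (q + r * z).
  move=> nQz; apply: contrapT => none.
  pose Y x := exists q r, Q q /\ x = q + r * z.
  have QY x : Q x -> Y x by move=> Qx; exists x, 0; rewrite mul0r addr0.
  have Yz : Y z by exists 0, 1; rewrite mul1r add0r; case: hX.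
  apply: (maxX Y).
    split; last by move=> E; apply: nQz; left; apply: E.
    by move=> x Xx; apply: QY; left.
  have -> : ext0 Y = Y.
    apply/funext => x; apply/propext; split; last by left.
    by case=> // Ix; apply: QY; right.
  split; last by move=> _ [q [r [Qq ->]]] Sx; apply: none; exists q, r.
  case: hX => Q0 QD QM; split; first exact: QY.
    move=> _ _ [q [r [Qq ->]]] [q' [r' [Qq' ->]]].
    by exists (q + q'), (r + r'); split; [exact: QD | ring].
  move=> t _ [q [r [Qq ->]]]; exists (t * q), (t * r).
  by split; [exact: QM | ring].
exists Q; split=> //; last by move=> x Ix; right.
split=> //; first by move/disX.
move=> x y Qxy; apply: contrapT => /not_orP[/out[q [r [Qq Sq]]] /out[q' [r' [Qq' Sq']]]].
apply: (disX _ _ (SM _ _ Sq Sq')).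
have -> : (q + r * x) * (q' + r' * y) =
  (q' + r' * y) * q + (r * x) * q' + (r * r') * (x * y) by ring.
by case: hX => _ QD QM; apply: (QD); [apply: (QD)|]; apply: QM.
Qed.

(** This stands for localizing at [P] and at [x]: the set to be avoided consists of the products
    [s * x ^+ n] with [s] outside [P]. *)
Lemma prime_below I P x : is_ideal I -> is_prime P ->
    (forall s n, I (s * x ^+ n) -> P s) ->
  exists Q, [/\ is_prime Q, (forall z, I z -> Q z), (forall z, Q z -> P z) & ~ Q x].
Proof.
move=> hI [iP P1 hP] dis.
pose S z := exists s n, ~ P s /\ z = s * x ^+ n.
have [||z y|z Iz|Q [pQ IQ disQ _]] := @prime_disjoint I S.
- exact: hI.
- by exists 1, 0%N; rewrite expr0 mulr1.
- move=> [s [n [Ps ->]]] [t [m [Pt ->]]]; exists (s * t), (n + m)%N.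
  by split; [move/hP => [] | rewrite exprD; ring].
- by move=> [s [n [Ps E]]]; apply: Ps; apply: (dis s n); rewrite -E.
exists Q; split=> //.
- move=> z Qz; apply: contrapT => Pz; apply: (disQ _ Qz).
  by exists z, 0%N; rewrite expr0 mulr1.
- by move=> Qx; apply: (disQ _ Qx); exists 1, 1%N; rewrite mul1r expr1.
Qed.

(** At [P], the radical of [I] is the intersection of the primes between [I] and [P]; denominators
    are cleared into [s]. *)
Lemma local_radicalP I P x : is_ideal I -> is_prime P ->
    (forall Q, is_prime Q -> (forall z, I z -> Q z) -> (forall z, Q z -> P z) -> Q x) ->
  exists s n, ~ P s /\ I (s * x ^+ n).
Proof.
move=> hI pP allQ; apply: contrapT => none.
have [||s n Isx|Q [pQ IQ QP]] := @prime_below I P x => //.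
  by apply: contrapT => Ps; apply: none; exists s, n.
by apply; apply: allQ.
Qed.

(** Absence of such chains of length [n.+1] expresses that the localization of R/I at [P] has
    dimension at most [n]. *)
Definition chain_between I P n := exists c : nat -> R -> Prop,
  [/\ (forall k, (k <= n)%N -> is_prime (c k)),
      (forall k, (k < n)%N -> psubset (c k) (c k.+1)),
      (forall x, I x -> c 0%N x) & (forall x, c n x -> P x)].

(* Kronecker's theorem localized at [P] and relative to [I]: [y] is obtained from
   [b] by adding multiples of [a] (whence the second clause), and [a] lies in the
   radical of [y] at [P]. *)
Lemma kronecker P n : is_prime P -> forall I, is_ideal I ->
    ~ chain_between I P n.+1 ->
  forall a (b : seq R), size b = n -> P a ->
  exists y : seq R, [/\ size y = n,
    (forall Q, is_ideal Q -> Q a ->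
       (forall z, z \in y -> Q z) <-> (forall z, z \in b -> Q z)) &
    (forall Q, is_prime Q -> (forall z, I z -> Q z) -> (forall z, Q z -> P z) ->
       (forall z, z \in y -> Q z) -> Q a)].
Proof.
move=> pP; elim: n => [|n IH] I hI noch a b sb Pa.
  exists [::]; split=> //; first by case: b sb.
  move=> Q pQ IQ QP _; apply: contrapT => nQa; apply: noch.
  exists (fun k => if k is 0%N then Q else P); split=> //.
  - by case.
  - by case=> // _; split=> //; exists a.
case: b sb => // b0 b [sb].
pose X Q := [/\ is_prime Q, (forall z, I z -> Q z) & (forall z, Q z -> P z)].
have Xi Q : X Q -> is_ideal Q by case=> -[].
(* the boundary ideal of [b0], enlarged by [y] *)
pose K (y : seq R) z := exists w, (forall Q, X Q -> Q (w * b0)) /\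
  (forall Q, X Q -> (forall u, u \in y -> Q u) -> Q b0 -> Q (z - w)).
have K_of0 y z : (forall Q, X Q -> (forall u, u \in y -> Q u) -> Q b0 -> Q z) -> K y z.
  move=> h; exists 0; split=> Q XQ; rewrite ?mul0r; first by case: (Xi _ XQ).
  by rewrite subr0; apply: h.
have KI y z : I z -> K y z by move=> Iz; apply: K_of0 => Q [_ IQ _] _ _; apply: IQ.
have hK y : is_ideal (K y).
  split; first by apply: KI; case: hI.
    move=> z z' [w [h1 h2]] [w' [h1' h2']]; exists (w + w'); split=> Q XQ.
      by rewrite mulrDl; case: (Xi _ XQ) => _ hD _; apply: hD; [apply: h1|apply: h1'].
    move=> Qy Qb; rewrite opprD addrACA; case: (Xi _ XQ) => _ hD _.
    by apply: hD; [apply: h2|apply: h2'].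
  move=> r z [w [h1 h2]]; exists (r * w); split=> Q XQ.
    by rewrite -mulrA; case: (Xi _ XQ) => _ _ hM; apply: hM; apply: h1.
  by move=> Qy Qb; rewrite -mulrBr; case: (Xi _ XQ) => _ _ hM; apply: hM; apply: h2.
have [||||y [sy yb ya]] := IH (K [::]) _ _ a b => //.
  (* A chain over the boundary ideal extends downwards: its least prime contains [b0] and each [w]
     with [w * b0] in all primes of [X], so a smaller prime over [I] avoids [b0]. *)
  move=> [c [pc cc Kc cP]]; apply: noch.
  have c0P x : c 0%N x -> P x.
    have: forall k, (k <= n.+1)%N -> forall x, c 0%N x -> c k x.
      by elim=> // k IHk kn z c0z; apply: (proj1 (cc k kn)); apply: IHk => //; apply: ltnW.
    by move=> h c0x; apply: cP; apply: h.
  have [||s m Isb|Q [pQ IQ Qc nQb]] := @prime_below I (c 0%N) b0 => //.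
  - exact: pc.
  - apply: Kc; exists s; split=> Q XQ; last by rewrite subrr; case: (Xi _ XQ).
    case: (XQ) => pQ IQ _; case: (pQ) => -[_ _ hM] _ QM.
    by have [Qs|/(primeX pQ) Qb] := QM _ _ (IQ _ Isb); [rewrite mulrC|]; apply: hM.
  exists (fun k => if k is k'.+1 then c k' else Q); split=> //.
  - by case=> // k; apply: pc.
  - case=> [_|k]; last exact: cc.
    split=> //; exists b0; split=> //; apply: Kc; exact: K_of0.
have [|s [m [Ps [w [wb wy]]]]] := local_radicalP (x := a) (hK y) pP.
  move=> Q pQ KQ QP; apply: ya => // z.
    by case=> w [h1 h2]; apply: KQ; exists w; split=> // Q' XQ' _; apply: h2.
  by move=> zy; apply/KQ/K_of0 => Q' _ /(_ _ zy).
(* As [w * b0] lies in every prime of [X], such a prime containing [b0 + a * w] and [y] contains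
   both [b0] and [a * w]; if [w] is in it, so is [s * a ^+ m], hence [a]. *)
exists (b0 + a * w :: y); split; first by rewrite /= sy.
  move=> Q hQ Qa; case: (hQ) => _ hD hM; have [yb1 yb2] := yb Q hQ Qa.
  have Qaw : Q (a * w) by rewrite mulrC; apply: hM.
  have E : Q (b0 + a * w) <-> Q b0.
    by split=> h; [rewrite -(addrK (a * w) b0); apply: idealB | apply: hD].
  split=> h z; rewrite inE => /orP[/eqP->|zy].
  - by apply/E/h; rewrite mem_head.
  - by apply: yb1 => // u uy; apply: h; rewrite inE uy orbT.
  - by apply/E/h; rewrite mem_head.
  - by apply: yb2 => // u uy; apply: h; rewrite inE uy orbT.
move=> Q pQ IQ QP Qy; have XQ : X Q by [].
have hQ := Xi _ XQ; have hQM : forall x y, Q (x * y) -> Q x \/ Q y by case: pQ.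
have Qy0 : Q (b0 + a * w) by apply: Qy; rewrite mem_head.
have Qy1 z : z \in y -> Q z by move=> zy; apply: Qy; rewrite inE zy orbT.
have Qb : Q b0.
  case: (hQM _ _ (wb _ XQ)) => // Qw; rewrite -(addrK (a * w) b0).
  by apply: idealB => //; case: hQ => _ _ hM; apply: hM.
have Qaw : Q (a * w) by rewrite -(addKr b0 (a * w)) addrC; apply: idealB.
case: (hQM _ _ Qaw) => // Qw.
have [|/QP/Ps[]|/(primeX pQ)//] := hQM s (a ^+ m).
by apply: (idealBl hQ _ Qw); apply: wy.
Qed.

(** The elements of [x] are absorbed one at a time, starting from [n] zeros; a prime below [P]
    containing the new [y'] contains [a] and therefore the old [y]. *)
Lemma generic_radical P n (x : seq R) : is_prime P -> ~ prime_chain_in P n.+1 ->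
    (forall z, z \in x -> P z) ->
  exists y : seq R, [/\ size y = n, (forall z, z \in y -> P z) &
    forall Q, is_prime Q -> (forall z, Q z -> P z) ->
      (forall z, z \in y -> Q z) -> forall z, z \in x -> Q z].
Proof.
move=> pP noch; have hP : is_ideal P by case: pP.
elim: x => [|a x IH] xP.
  by exists (nseq n 0); split=> //; rewrite ?size_nseq // => z /nseqP[-> _]; case: hP.
have [|y [sy yP yx]] := IH; first by move=> z zx; apply: xP; rewrite inE zx orbT.
have Pa : P a by apply: xP; rewrite mem_head.
have [|y' [sy' y'y y'a]] := kronecker pP is_ideal_zero (n := n) _ sy Pa.
  by move=> [c [c1 c2 _ c3]]; apply: noch; exists c.
exists y'; split=> //; first exact/(y'y P hP Pa).
move=> Q pQ QP Qy' z; have hQ : is_ideal Q by case: pQ.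
have Qa : Q a by apply: y'a => // u ->; case: hQ.
by rewrite inE => /orP[/eqP->//|zx]; apply: yx zx => //; apply/(y'y Q hQ Qa).
Qed.
End Primes.

(** * Iterated cones *)

Section Complexes.
Variable R : comNzRingType.

Section LinearFun.
Variables (U V : lmodType R) (g : U -> V).
Hypothesis gP : linear g.

Lemma lin0 : g 0 = 0.
Proof. by apply: (addrI (g 0)); rewrite -{1}[g 0]scale1r -gP scale1r !addr0. Qed.

Lemma linD u v : g (u + v) = g u + g v.
Proof. by rewrite -{1}[u]scale1r gP scale1r. Qed.

Lemma linZ a u : g (a *: u) = a *: g u.
Proof. by rewrite -[a *: u]addr0 gP lin0 addr0. Qed.

Lemma linN u : g (- u) = - g u.
Proof. by rewrite -scaleN1r linZ scaleN1r. Qed.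

Lemma linB u v : g (u - v) = g u - g v.
Proof. by rewrite linD linN. Qed.
End LinearFun.

(* Cochains of all degrees live in one module; [deg k] is the submodule of
   those of degree [k - 1], so that [deg 0] plays the role of degree -1. *)
Record complex := Complex {
  car :> lmodType R;
  deg : nat -> car -> Prop;
  dif : car -> car;
  deg0 : forall k, deg k 0;
  degP : forall k a u v, deg k u -> deg k v -> deg k (a *: u + v);
  difP : linear dif }.

Section ComplexTheory.
Variables (C : complex) (k : nat).
Implicit Types u v : C.

Lemma degZ a u : deg k u -> deg k (a *: u).
Proof. by move=> h; rewrite -[_ *: _]addr0; apply: degP (deg0 _ _). Qed.

Lemma degN u : deg k u -> deg k (- u).
Proof. by rewrite -scaleN1r; apply: degZ. Qed.

Lemma degD u v : deg k u -> deg k v -> deg k (u + v).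
Proof. by move=> h; rewrite -[u]scale1r; apply: degP. Qed.

Lemma degB u v : deg k u -> deg k v -> deg k (u - v).
Proof. by move=> h h'; apply: degD => //; apply: degN. Qed.
End ComplexTheory.

Section Cone.
Variables (u : R) (C : complex).

(** The second component is shifted by one. The truncated predecessor at index 0 is harmless, as
    that part is zero in complexes built from [base]. *)
Definition cone_deg k (p : C * C) := deg k p.1 /\ deg k.-1 p.2.
(** The total complex of multiplication by [u] on [C]; iterated over a sequence it is the Koszul
    complex with coefficients in [C]. *)
Definition cone_dif (p : C * C) : C * C := (dif p.1, u *: p.1 - dif p.2).

Lemma cone_deg0 k : cone_deg k 0.
Proof. by split; apply: deg0. Qed.

Lemma cone_degP k a p q : cone_deg k p -> cone_deg k q -> cone_deg k (a *: p + q).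
Proof. by move=> [h1 h2] [h3 h4]; split; apply: degP. Qed.

Lemma cone_difP : linear cone_dif.
Proof.
move=> a p q; congr pair; rewrite /= !difP // scalerDr scalerBr !scalerA (mulrC u).
by rewrite opprD addrACA.
Qed.

Definition cone := Complex (car := (C * C)%type) cone_deg0 cone_degP cone_difP.
End Cone.

Definition base_deg (V : lmodType R) (M : V -> Prop) k v :=
  if k == 1%N then M v else v = 0.

Section Base.
Variables (V : lmodType R) (M : V -> Prop).
Hypotheses (M0 : M 0) (MP : forall a u v, M u -> M v -> M (a *: u + v)).

Lemma base_deg0 k : base_deg M k 0.
Proof. by rewrite /base_deg; case: eqP. Qed.

Lemma base_degP k a u v : base_deg M k u -> base_deg M k v -> base_deg M k (a *: u + v).
Proof.
by rewrite /base_deg; case: eqP => _; [apply: MP|move=> -> ->; rewrite scaler0 addr0].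
Qed.

Lemma base_difP : linear (fun _ : V => 0 : V).
Proof. by move=> a u v; rewrite scaler0 addr0. Qed.

Definition base := Complex base_deg0 base_degP base_difP.
End Base.

Definition koszul (s : seq R) (C : complex) := foldr cone C s.

(* [t] kills the cohomology of [C] in (ordinary) degrees [<= n]. *)
Definition vanish (t : R) n (C : complex) := forall k (a : C), (k <= n.+1)%N ->
  deg k a -> dif a = 0 -> exists2 g : C, deg k.-1 g & dif g = t *: a.

Definition nullhtp (r : R) (C : complex) := exists h : C -> C,
  [/\ linear h,
      forall k u, deg k u -> deg k.-1 (h u) &
      forall u, dif (h u) + h (dif u) = r *: u].

(** Homotopies add and scale, so null-homotopy has to be checked only on generators of an ideal. *)
Lemma nullhtp_ideal C : is_ideal (nullhtp^~ C).
Proof.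
split.
- exists (fun=> 0); split=> [a u v|k u _|u]; first by rewrite scaler0 addr0.
    exact: deg0.
  by rewrite (lin0 (@difP _)) addr0 scale0r.
- move=> x y [h [hP hd hh]] [h' [hP' hd' hh']]; exists (fun u => h u + h' u).
  split=> [a u v|k u du|u]; first by rewrite hP hP' scalerDr addrACA.
    by apply: degD; [apply: hd|apply: hd'].
  by rewrite (linD (@difP _)) addrACA hh hh' scalerDl.
- move=> r x [h [hP hd hh]]; exists (fun u => r *: h u).
  split=> [a u v|k u du|u].
  + by rewrite hP scalerDr !scalerA (mulrC r).
  + by apply: degZ; apply: hd.
  + by rewrite (linZ (@difP _)) -scalerDr hh scalerA.
Qed.

Lemma nullhtp_cone_self u C : nullhtp u (cone u C).
Proof.
exists (fun p => (p.2, 0)); split=> [a p q|k p [h1 h2]|p].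
- by congr pair; rewrite /= scaler0 addr0.
- by split=> //=; apply: deg0.
- by congr pair; rewrite /= ?(lin0 (@difP _)) ?subr0 ?addr0 // addrC subrK.
Qed.

Lemma nullhtp_cone u r C : nullhtp r C -> nullhtp r (cone u C).
Proof.
move=> [h [hP hd hh]].
exists (fun p => (h p.1, - h p.2)); split=> [a p q|k p [h1 h2]|p].
- by congr pair; rewrite /= !hP // opprD scalerN.
- by split=> /=; [apply: hd | apply: degN; apply: hd].
- congr pair => /=; first exact: hh.
  rewrite (linB hP) (linZ hP) opprB (linN (@difP _)) opprK -hh addrC addrA.
  by rewrite subrK addrC.
Qed.

Lemma nullhtp_koszul s r C : nullhtp r C -> nullhtp r (koszul s C).
Proof. by elim: s => //= u s IH /IH; apply: nullhtp_cone. Qed.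

Lemma nullhtp_mem s r C : r \in s -> nullhtp r (koszul s C).
Proof.
elim: s => //= u s IH; rewrite inE => /orP[/eqP->|/IH]; first exact: nullhtp_cone_self.
exact: nullhtp_cone.
Qed.

(** The long exact sequence on elements: with [a = dif g], the defect [u *: g - b] is a cocycle one
    degree lower, and its primitive completes [g]. *)
Lemma vanish_cone n u C : vanish 1 n C -> vanish 1 n (cone u C).
Proof.
move=> vC k [a b] kn [/= da db] [Ea Eb].
have [g dg Eg] := vC _ _ kn da Ea; rewrite scale1r in Eg.
have [|||e de Ee] := vC k.-1 (u *: g - b).
- by apply: leq_trans kn; apply: leq_pred.
- by apply: degB db; apply: degZ.
- by rewrite (linB (@difP _)) (linZ (@difP _)) Eg.
exists (g, e); rewrite ?scale1r; first by split.
by congr pair; rewrite /= ?Eg // Ee scale1r opprB addrC subrK.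
Qed.

Lemma vanish_koszul n s C : vanish 1 n C -> vanish 1 n (koszul s C).
Proof. by elim: s => //= u s IH /IH; apply: vanish_cone. Qed.

(** The homotopy makes [u ^+ N *: (s *: a)] a boundary. If [u ^+ M.+1 *: a = dif b], then
    [(u ^+ M *: a, b)] is a cocycle of the cone, so one factor [u] can be traded for one factor
    [t]. *)
Lemma vanish_uncone t n u s N C : vanish t n (cone u C) -> nullhtp (s * u ^+ N) C ->
  vanish (t ^+ N * s) n C.
Proof.
move=> vC [h [hP hd hh]].
have key M k (a b : C) : (k <= n.+1)%N -> deg k a -> deg k.-1 b -> dif a = 0 ->
    u ^+ M *: a = dif b -> exists2 g : C, deg k.-1 g & dif g = t ^+ M *: a.
  move=> kn; elim: M a b => [|M IH] a b da db Ea.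
    by rewrite !expr0 => E; exists b.
  rewrite exprS => E.
  have [|||[g1 g2] [/= dg1 dg2] [E1 E2]] := vC k (u ^+ M *: a, b) => //.
  - by split=> //; apply: degZ.
  - by congr pair; rewrite /= ?(linZ (@difP _)) ?Ea ?scaler0 // scalerA E subrr.
  have [||||g dg Eg] := IH (t *: a) g1 => //.
  - exact: degZ.
  - by rewrite (linZ (@difP _)) Ea scaler0.
  - by rewrite scalerA mulrC -scalerA; exact: esym E1.
  by exists g => //; rewrite Eg scalerA exprSr.
move=> k a kn da Ea.
have [|||||g dg Eg] := key N k (s *: a) (h a) => //.
- exact: degZ.
- exact: hd.
- by rewrite (linZ (@difP _)) Ea scaler0.
- by rewrite -[LHS]addr0 scalerA mulrC -hh Ea (lin0 hP) !addr0.
by exists g => //; rewrite Eg scalerA.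
Qed.

(** It is applied to reorderings of cones; the one-sided inverse is what carries vanishing from [C]
    to [C']. *)
Definition retract (C C' : complex) := exists (g : C -> C') (g' : C' -> C),
  [/\ linear g, linear g',
      (forall k u, deg k u -> deg k (g u)) /\ (forall u, dif (g u) = g (dif u)),
      (forall k u, deg k u -> deg k (g' u)) /\ (forall u, dif (g' u) = g' (dif u)) &
      cancel g' g].

Lemma retract_refl C : retract C C.
Proof. by exists id, id; split. Qed.

Lemma retract_trans C2 C1 C3 : retract C1 C2 -> retract C2 C3 -> retract C1 C3.
Proof.
move=> [g [g' [gP gP' [gd gf] [gd' gf'] K]]] [e [e' [eP eP' [ed ef] [ed' ef'] L]]].
exists (e \o g), (g' \o e'); split=> /=.
- by move=> a u v; rewrite /= gP eP.
- by move=> a u v; rewrite /= eP' gP'.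
- by split=> [k u du|u]; [apply/ed/gd | rewrite ef gf].
- by split=> [k u du|u]; [apply/gd'/ed' | rewrite gf' ef'].
- by move=> x /=; rewrite K L.
Qed.

Lemma retract_cone u C C' : retract C C' -> retract (cone u C) (cone u C').
Proof.
move=> [g [g' [gP gP' [gd gf] [gd' gf'] K]]].
exists (fun p => (g p.1, g p.2)), (fun p => (g' p.1, g' p.2)); split.
- by move=> a p q; congr pair; rewrite /= gP.
- by move=> a p q; congr pair; rewrite /= gP'.
- by split=> [k p [d1 d2]|p]; [split; apply: gd | congr pair; rewrite /= gf // (linB gP) (linZ gP)].
- by split=> [k p [d1 d2]|p]; [split; apply: gd' | congr pair; rewrite /= gf' // (linB gP') (linZ gP')].
- by move=> [a b]; rewrite /= !K.
Qed.

(** Exchanging two exterior generators changes the sign of the component containing both. *)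
Lemma retract_swap u v C : retract (cone u (cone v C)) (cone v (cone u C)).
Proof.
pose g (D := cone u (cone v C)) : D -> D :=
  fun p => ((p.1.1, p.2.1), (p.1.2, - p.2.2)).
exists g, g; split.
- by move=> a p q; congr (_, _, (_, _)); rewrite /= opprD scalerN.
- by move=> a p q; congr (_, _, (_, _)); rewrite /= opprD scalerN.
- split=> [k [[a b] [c e]] [[d1 d2] [d3 d4]]|[[a b] [c e]]].
    by split; split=> //=; apply: degN.
  congr (_, _, (_, _)); rewrite /= (linN (@difP _)) opprK ?opprB.
  by rewrite opprD addrA addrAC.
- split=> [k [[a b] [c e]] [[d1 d2] [d3 d4]]|[[a b] [c e]]].
    by split; split=> //=; apply: degN.
  congr (_, _, (_, _)); rewrite /= (linN (@difP _)) opprK ?opprB.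
  by rewrite opprD addrA addrAC.
- by move=> [[a b] [c e]]; rewrite /g /= opprK.
Qed.

Lemma retract_middle s u C : retract (koszul s (cone u C)) (cone u (koszul s C)).
Proof.
elim: s => [|v s IH] /=; first exact: retract_refl.
exact: retract_trans (retract_cone v IH) (retract_swap v u _).
Qed.

Lemma retract_koszulC s t C : retract (koszul s (koszul t C)) (koszul t (koszul s C)).
Proof.
elim: t => [|u t IH] /=; first exact: retract_refl.
exact: retract_trans (retract_middle _ _ _) (retract_cone u IH).
Qed.

Lemma vanish_retract n t C C' : retract C C' -> vanish t n C -> vanish t n C'.
Proof.
move=> [g [g' [gP gP' [gd gf] [gd' gf'] K]]] vC k a kn da Ea.
have [||e de Ee] := vC k (g' a) kn; first exact: gd'.
  by rewrite gf' Ea (lin0 gP').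
exists (g e); first exact: gd.
by rewrite gf Ee (linZ gP) K.
Qed.

(** Vanishing passes to the Koszul complex on [x] and [y] together; each element of [y] is then
    removed, being null-homotopic on the complex of [x]. All multipliers stay 1. *)
Lemma vanish_subideal n x y C : (forall z, z \in y -> nullhtp z (koszul x C)) ->
  vanish 1 n (koszul y C) -> vanish 1 n (koszul x C).
Proof.
move=> nul vy; have {vy} := vanish_retract (retract_koszulC x y C) (vanish_koszul (s := x) vy).
elim: y nul => //= u y IH nul vuy; apply: IH => [z zy|].
  by apply: nul; rewrite inE zy orbT.
have /vanish_uncone : vanish 1 n (cone u (koszul y (koszul x C))) by [].
move=> /(_ 1 1%N); rewrite !mul1r expr1; apply.
by apply: nullhtp_koszul; apply: nul; rewrite mem_head.
Qed.

Lemma vanish_local P n x C : is_prime P ->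
    (forall z, z \in x -> exists s N, ~ P s /\ nullhtp (s * z ^+ N) C) ->
    vanish 1 n (koszul x C) -> exists2 t, ~ P t & vanish t n C.
Proof.
move=> pP; have [hP P1 PM] := pP.
(* Removing [u] replaces [t] by [t ^+ N * s], so the induction runs over all [t] outside [P]. *)
suff gen t : ~ P t -> (forall z, z \in x -> exists s N, ~ P s /\ nullhtp (s * z ^+ N) C) ->
    vanish t n (koszul x C) -> exists2 t, ~ P t & vanish t n C by exact: gen.
elim: x t => [|u x IH] t Pt nul vx; first by exists t.
have [s [N [Ps hN]]] := nul u (mem_head _ _).
apply: (IH (t ^+ N * s)).
- by case/PM => // /(primeX pP).
- by move=> z zx; apply: nul; rewrite inE zx orbT.
- by apply: vanish_uncone vx _; apply: nullhtp_koszul.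
Qed.

(** * Top cohomology and chains of primes *)

Definition ring_complex := base (V := R^o) (M := fun=> True) I (fun _ _ _ _ _ => I).

(** The dual of the product of all exterior generators; its class generates the top cohomology
    R/(y). *)
Fixpoint topclass (y : seq R) : koszul y ring_complex :=
  match y with
  | [::] => (1 : R)
  | u :: y' => (0, topclass y')
  end.

Fixpoint topcoef (y : seq R) : koszul y ring_complex -> R :=
  match y return koszul y ring_complex -> R with
  | [::] => fun v => v
  | u :: y' => fun p => topcoef p.2
  end.

Lemma topclass_deg y : deg (size y).+1 (topclass y).
Proof. by elim: y => //= u y IH; split=> //; apply: deg0. Qed.

Lemma topclass_dif y : dif (topclass y) = 0.
Proof. by elim: y => //= u y IH; rewrite /cone_dif /= IH (lin0 (@difP _)) scaler0 subr0. Qed.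

Lemma topcoefP y : linear (topcoef (y := y) : _ -> R^o).
Proof. by elim: y => //= w y IH a [u1 u2] [v1 v2]; apply: IH. Qed.

(** Top coefficients of boundaries are combinations of the elements of [y]: each cone contributes
    [u] times a coefficient. *)
Lemma topcoef_dif (I : R -> Prop) y (g : koszul y ring_complex) : is_ideal I ->
  (forall z, z \in y -> I z) -> I (topcoef (dif g)).
Proof.
move=> hI; elim: y g => [|u y IH] g yI; first by case: hI.
case: g => [a b] /=; rewrite (linB (@topcoefP y)) (linZ (@topcoefP y)).
apply: idealB => //; last by apply: IH => z zy; apply: yI; rewrite inE zy orbT.
case: hI => _ _ hM; rewrite [_ *: _]mulrC; apply: hM; apply: yI; exact: mem_head.
Qed.

Lemma vanish_topclass t (I : R -> Prop) y : is_ideal I -> (forall z, z \in y -> I z) ->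
  vanish t (size y) (koszul y ring_complex) -> I t.
Proof.
move=> hI yI vy.
have [g dg Eg] := vy _ _ (leqnn _) (topclass_deg y) (topclass_dif y).
have := topcoef_dif g hI yI; rewrite Eg.
suff -> : topcoef (t *: topclass y) = t by [].
by elim: y {yI vy g dg Eg} => [|u y] /=; first exact: mulr1.
Qed.

Lemma vanish_prime_chain P n (x : seq R) : is_prime P -> (forall z, z \in x -> P z) ->
  vanish 1 n (koszul x ring_complex) -> prime_chain_in P n.+1.
Proof.
move=> pP xP vx; apply: contrapT => noch.
have [y [sy yP yrad]] := generic_radical pP noch xP.
have [|t Pt vt] := vanish_local (C := koszul y ring_complex) (x := x) pP _
  (vanish_retract (retract_koszulC y x _) (vanish_koszul (s := y) vx)).
  (* The elements null-homotopic on the complex of [y] form an ideal containing [y], so its radical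
     at [P] contains [x]. *)
  move=> z zx; apply: local_radicalP (nullhtp_ideal _) pP _ => Q pQ nQ QP.
  by apply: (yrad Q) zx => // u uy; apply: nQ; apply: nullhtp_mem.
by apply/Pt/(@vanish_topclass _ _ y) => //; [case: pP|rewrite sy].
Qed.

End Complexes.

(** * Cochains on subsets *)

Definition kvanish (R : comNzRingType) (V : zmodType) (act : R -> V -> V) (M : V -> Prop)
  (l : nat) (x : 'I_l -> R) (i : nat) :=
  forall phi, kcochain M i phi -> kcocycle act x i phi -> kcoboundary act M x i phi.

Lemma kgrade_gens_ge (R : comNzRingType) (V : zmodType) (act : R -> V -> V)
    (M : V -> Prop) (l : nat) (x : 'I_l -> R) n :
  ele (Fin n.+1) (kgrade_gens act M x) <->
  (forall i, (i <= n)%N -> kvanish act M x i).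
Proof.
have [lb glb] := einfP (fun e => exists i, e = Fin i /\ koszul_H_nonzero act M x i).
split=> [ge i le_in phi c1 c2|van].
  apply: contrapT => nb; suff : ele (Fin n.+1) (Fin i) by rewrite /= ltnNge le_in.
  by apply: ele_trans ge (lb _ _); exists i; split=> //; exists phi.
apply: glb => _ [i [-> [phi [c1 c2 nb]]]] /=.
by rewrite ltnNge; apply/negP => le_in; apply/nb/van.
Qed.

(** * Subsets split by membership of the first index *)

Section TailSets.
Variable n : nat.
Implicit Types (S : {set 'I_n.+1}) (T : {set 'I_n}).

Definition tailset S : {set 'I_n} := [set i | lift ord0 i \in S].

Lemma tailset_lift T : tailset (lift ord0 @: T) = T.
Proof. by apply/setP => i; rewrite inE mem_imset //; apply: lift_inj. Qed.

Lemma ord0_lift T : (ord0 \in lift ord0 @: T) = false.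
Proof. by apply/imsetP => -[i _ /eqP]; rewrite (negPf (neq_lift _ _)). Qed.

Lemma tailset_lift0 T : tailset (ord0 |: lift ord0 @: T) = T.
Proof.
apply/setP => i; rewrite !inE eq_sym (negPf (neq_lift _ _)) mem_imset //.
exact: lift_inj.
Qed.

Lemma tailsetP S :
  S = if ord0 \in S then ord0 |: lift ord0 @: tailset S else lift ord0 @: tailset S.
Proof.
apply/setP => i; case: (unliftP ord0 i) => [j ->|->]; last first.
  by case: ifP => h; rewrite ?inE ?eqxx ?ord0_lift.
case: ifP => _; rewrite ?inE ?(negPf (neq_lift _ _)) ?mem_imset ?inE //;
  exact: lift_inj.
Qed.

Lemma card_tailset S : #|S| = ((ord0 \in S) + #|tailset S|)%N.
Proof.
rewrite {1}(tailsetP S); have inj := card_imset _ (@lift_inj n.+1 ord0).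
by case: ifP => _; rewrite ?cardsU1 ?ord0_lift inj.
Qed.

Lemma tailsetD1 S : tailset (S :\ ord0) = tailset S.
Proof. by apply/setP => i; rewrite !inE eq_sym neq_lift. Qed.

Lemma tailsetD1_lift S j : tailset (S :\ lift ord0 j) = tailset S :\ j.
Proof. by apply/setP => i; rewrite !inE (inj_eq lift_inj). Qed.

(** The index 0 lies below every lifted index, so its presence in [S] flips the Koszul sign; this is
    the minus sign in the cone. *)
Lemma card_below_lift S (j : 'I_n) :
  #|[set k in S | (k < lift ord0 j)%N]| =
  ((ord0 \in S) + #|[set k in tailset S | (k < j)%N]|)%N.
Proof.
rewrite card_tailset inE /= andbT; congr (_ + _)%N; apply: eq_card => k.
by rewrite !inE /= /bump /= ltnS.
Qed.
End TailSets.

(** * Identification of subset cochains with iterated cones *)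

Section Bridge.
Variables (R : comNzRingType) (V : lmodType R) (M : V -> Prop).
Hypotheses (M0 : M 0) (MP : forall a u v, M u -> M v -> M (a *: u + v)).

Local Notation act := (fun (r : R) (v : V) => r *: v).
Local Notation K s := (koszul s (base M0 MP)).
Local Notation gens s := (fun j : 'I_(size s) => s`_j).

Fixpoint to_cochain s : K s -> {set 'I_(size s)} -> V :=
  match s return K s -> {set 'I_(size s)} -> V with
  | [::] => fun v _ => v
  | u :: s' => fun p S =>
      if ord0 \in S then to_cochain p.2 (tailset S) else to_cochain p.1 (tailset S)
  end.

Fixpoint of_cochain s : ({set 'I_(size s)} -> V) -> K s :=
  match s return ({set 'I_(size s)} -> V) -> K s with
  | [::] => fun phi => phi set0
  | u :: s' => fun phi => (of_cochain (fun T => phi (lift ord0 @: T)),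
                           of_cochain (fun T => phi (ord0 |: lift ord0 @: T)))
  end.

Lemma of_cochainK s : cancel (@of_cochain s) (@to_cochain s).
Proof.
elim: s => [|u s IH] phi; apply/funext => S /=.
  by congr phi; apply/setP => -[].
by rewrite !IH [in RHS](tailsetP S); case: ifP.
Qed.

Lemma to_cochainK s : cancel (@to_cochain s) (@of_cochain s).
Proof.
elim: s => [|u s IH] //= [a b] /=; congr pair; rewrite -[RHS]IH; congr of_cochain;
  apply/funext => T.
  by rewrite ord0_lift tailset_lift.
by rewrite !inE eqxx tailset_lift0.
Qed.

Lemma koszul_d_ext l (x : 'I_l -> R) (phi psi : {set 'I_l} -> V) (S : {set 'I_l}) :
  (forall j, j \in S -> phi (S :\ j) = psi (S :\ j)) ->
  koszul_d act x phi S = koszul_d act x psi S.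
Proof. by move=> E; apply: eq_bigr => j /E ->. Qed.

(** The summand at 0 is multiplication by the first element and the others form the differential of
    the tail: the cone formula. *)
Lemma koszul_d_cons l (x : 'I_l.+1 -> R) (phi : {set 'I_l.+1} -> V) (S : {set 'I_l.+1}) :
  koszul_d act x phi S =
  if ord0 \in S then
    x ord0 *: phi (S :\ ord0) -
    koszul_d act (x \o lift ord0) (fun T => phi (ord0 |: lift ord0 @: T)) (tailset S)
  else koszul_d act (x \o lift ord0) (fun T => phi (lift ord0 @: T)) (tailset S).
Proof.
have E j : lift ord0 j \in S -> phi (S :\ lift ord0 j) =
   if ord0 \in S then phi (ord0 |: lift ord0 @: (tailset S :\ j))
   else phi (lift ord0 @: (tailset S :\ j)).
  by move=> _; rewrite {1}[S :\ _]tailsetP tailsetD1_lift !inE /=; case: (ord0 \in S).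
rewrite /koszul_d big_mkcond big_ord_recl /=.
rewrite (eq_bigr (fun j => if j \in tailset S then
  (-1) ^+ (ord0 \in S) *: (((-1) ^+ #|[set k in tailset S | (k < j)%N]| * x (lift ord0 j)) *:
   (if ord0 \in S then phi (ord0 |: lift ord0 @: (tailset S :\ j))
   else phi (lift ord0 @: (tailset S :\ j)))) else 0)); last first.
  move=> j _; rewrite inE; case: ifP => // jS.
  by rewrite (E j jS) card_below_lift exprD scalerA mulrA.
rewrite -big_mkcond /= -scaler_sumr.
case: ifP => h; rewrite ?expr0 ?scale1r ?add0r // expr1 scaleN1r.
rewrite (_ : [set k in S | (k < 0)%N] = set0) ?cards0 ?expr0 ?mul1r //.
by apply/setP => k; rewrite !inE andbF.
Qed.

Lemma to_cochainP s S : linear (fun p : K s => to_cochain p S).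
Proof.
elim: s S => [//|u s IH] S a [a1 b1] [a2 b2] /=.
by case: ifP => _; apply: IH.
Qed.

Lemma to_cochain_dif s (p : K s) :
  to_cochain (dif p) = koszul_d act (gens s) (to_cochain p).
Proof.
elim: s p => [|u s IH] p; apply/funext => S.
  by rewrite /koszul_d big1 // => -[].
have lin := @koszul_d_cons (size s) (gens (u :: s)).
rewrite lin /=; case: ifP => h.
  rewrite (linB (to_cochainP (tailset S))) (linZ (to_cochainP (tailset S))).
  rewrite !inE eqxx tailsetD1.
  congr (_ - _); rewrite [LHS](congr1 (@^~ _) (IH _)); apply: koszul_d_ext => j _ /=.
  by rewrite !inE eqxx tailset_lift0.
rewrite [LHS](congr1 (@^~ _) (IH _)); apply: koszul_d_ext => j _ /=.
by rewrite ord0_lift tailset_lift.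
Qed.

Lemma to_cochain_deg s k (p : K s) :
  deg k p <-> forall S : {set 'I_(size s)}, if #|S|.+1 == k then M (to_cochain p S) else to_cochain p S = 0.
Proof.
elim: s k p => [|u s IH] k p.
  rewrite /= /base_deg; split=> [h S|/(_ set0)].
    by rewrite (_ : #|S| = 0%N) 1?eq_sym //; apply: eq_card0 => -[].
  by rewrite cards0 eq_sym.
case: p => a b; split=> [[/IH da /IH db] S|h] /=.
  rewrite card_tailset; case: (ord0 \in S); last by rewrite add0n; have := da (tailset S).
  by rewrite add1n; have := db (tailset S); case: k {da db} => [|[|k]].
split; apply/IH => T /=.
  have /= := h (lift ord0 @: T).
  by rewrite card_tailset ord0_lift tailset_lift.
have /= := h (ord0 |: lift ord0 @: T).
rewrite card_tailset !inE eqxx tailset_lift0 add1n.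
by case: k {h} => [|[|k]].
Qed.

Lemma vanish_kvanish s n :
  vanish 1 n (K s) <-> forall i, (i <= n)%N -> kvanish act M (gens s) i.
Proof.
(* A cochain of degree [i] is constrained only on subsets of size [i]; truncation clears its other
   values to give a homogeneous element. *)
pose trunc (i : nat) (phi : {set 'I_(size s)} -> V) (S : {set 'I_(size s)}) := if #|S| == i then phi S else 0.
have trunc_deg i phi : kcochain M i phi -> deg i.+1 (of_cochain (trunc i phi)).
  move=> c; apply/to_cochain_deg => S; rewrite of_cochainK /trunc eqSS.
  by case: eqP => // /c.
have dif_trunc i phi S : to_cochain (dif (of_cochain (trunc i phi))) S =
    if #|S| == i.+1 then koszul_d act (gens s) phi S else 0.
  rewrite to_cochain_dif of_cochainK.
  have card j : j \in S -> (#|S :\ j| == i) = (#|S| == i.+1).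
    by move=> jS; rewrite (cardsD1 j S) jS.
  case: ifP => h.
    by apply: koszul_d_ext => j jS; rewrite /trunc card // h.
  by rewrite /koszul_d big1 // => j jS; rewrite /trunc card // h scaler0.
have eq_of (p q : K s) : (forall S, to_cochain p S = to_cochain q S) -> p = q.
  by move=> E; rewrite -[p]to_cochainK -[q]to_cochainK; congr of_cochain; apply/funext.
have to0 S : to_cochain (0 : K s) S = 0.
  exact: (lin0 (to_cochainP S)).
split=> [van i le_in phi c1 c2|van [|i] p le_in dp Ep].
- have [||g dg Eg] := van i.+1 (of_cochain (trunc i phi)) le_in.
  + exact: trunc_deg.
  + apply: eq_of => S; rewrite dif_trunc to0.
    by case: eqP => // /c2.
  rewrite scale1r in Eg.
  have E (S : {set 'I_(size s)}) : #|S| = i -> to_cochain (dif g) S = phi S.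
    by move=> sS; rewrite Eg of_cochainK /trunc sS eqxx.
  case: i {le_in c1 c2 Eg} E dg => [|i] E dg /= => [S sS|].
    by rewrite -E // to_cochain_dif /koszul_d big1 // => j; rewrite (cards0_eq sS) inE.
  exists (to_cochain g); split=> [S sS|S sS]; last by rewrite -to_cochain_dif E.
  by move/to_cochain_deg: dg => /(_ S); rewrite sS eqxx.
- exists 0; first exact: deg0.
  rewrite (lin0 (@difP _ _)) scale1r; apply: esym; apply: eq_of => S; rewrite to0.
  by move/to_cochain_deg: dp => /(_ S).
have kc : kcochain M i (to_cochain p).
  by move=> S sS; move/to_cochain_deg: dp => /(_ S); rewrite sS eqxx.
have kz : kcocycle act (gens s) i (to_cochain p).
  by move=> S _; rewrite -to_cochain_dif Ep to0.
have c := van i le_in _ kc kz; clear kc kz.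
case: i => [|i] in le_in dp c *.
  exists 0; first exact: deg0.
  rewrite (lin0 (@difP _ _)) scale1r; apply: esym; apply: eq_of => S; rewrite to0.
  by move/to_cochain_deg: dp => /(_ S); rewrite eqSS; case: eqP => // /c.
case: c => psi [c1 c2]; exists (of_cochain (trunc i psi)); first exact: trunc_deg.
rewrite scale1r; apply: eq_of => S; rewrite dif_trunc.
case: eqP => [/c2//|sS]; move/to_cochain_deg: dp => /(_ S).
by rewrite eqSS; case: eqP.
Qed.
End Bridge.

(** * Koszul grade *)

(** Trading indexed families for sequences gives access to the iterated cones. *)
Lemma tuple_seq (R : comNzRingType) (P : forall l, ('I_l -> R) -> Prop) :
  (forall s : seq R, P (size s) (fun j => s`_j)) -> forall l x, P l x.
Proof.
move=> Ps l x; have sz : size (codom x) = l by rewrite size_codom card_ord.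
have xE j : x j = (codom x)`_j.
  by rewrite (nth_map j) ?size_enum_ord // nth_ord_enum.
move: x sz xE => x; move: (codom x) => s sz; case: _ / sz x => x xE.
have -> : x = fun j => s`_j by apply/funext.
exact: Ps.
Qed.

Section GradeMonotone.
Variables (R : comNzRingType) (V : lmodType R) (M : V -> Prop).
Hypotheses (M0 : M 0) (MP : forall a u v, M u -> M v -> M (a *: u + v)).
Local Notation act := (fun (r : R) (v : V) => r *: v).

Lemma kgrade_gens_vanish s n :
  ele (Fin n.+1) (kgrade_gens act M (fun j : 'I_(size s) => s`_j)) <->
  vanish 1 n (koszul s (base M0 MP)).
Proof. exact: iff_trans (kgrade_gens_ge _ _ _ _) (iff_sym (vanish_kvanish _ _ _ _)). Qed.

(** The hypothesis says that [y] lies in the ideal generated by [x]; it is applied to the ideal of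
    elements null-homotopic on the complex of [x]. *)
Lemma kgrade_gens_le l m (x : 'I_l -> R) (y : 'I_m -> R) :
  (forall j (I : R -> Prop), is_ideal I -> (forall k, I (x k)) -> I (y j)) ->
  ele (kgrade_gens act M y) (kgrade_gens act M x).
Proof.
elim/tuple_seq: l / x => x; elim/tuple_seq: m / y => y yx.
apply: ele_of_Fin => n /kgrade_gens_vanish vy; apply/kgrade_gens_vanish.
apply: vanish_subideal vy => z /(nthP 0)[j jy <-].
apply: (yx (Ordinal jy) _ (nullhtp_ideal (koszul x (base M0 MP)))).
by move=> k; apply: nullhtp_mem; apply: mem_nth.
Qed.
End GradeMonotone.

Lemma kgrade_ge (R : comNzRingType) (V : zmodType) (act : R -> V -> V)
    (M : V -> Prop) (a : R -> Prop) l (x : 'I_l -> R) :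
  (forall j, a (x j)) -> ele (kgrade_gens act M x) (kgrade act M a).
Proof. by move=> ax; apply: (proj1 (esupP _)); exists l, x. Qed.

Lemma kgrade_le_height (R : comNzRingType) (a : R -> Prop) :
  ele (kgrade_self a) (height a).
Proof.
apply: (proj2 (einfP _)) => _ [P [pP aP ->]].
apply: (proj2 (esupP _)) => _ [l [x [ax ->]]].
elim/tuple_seq: l / x ax => s ax; apply: ele_of_Fin => n.
move=> /(@kgrade_gens_vanish R R^o (fun=> True) I (fun _ _ _ _ _ => I) s n) vs.
apply: (proj1 (esupP _)); exists n.+1; split=> //.
apply: vanish_prime_chain pP _ vs => z /(nthP 0)[j js <-].
exact: aP (ax (Ordinal js)).
Qed.

(** * Coefficient maps and the splitting of the amalgamation *)

Section Coefficients.
Variables (R R' : comNzRingType) (V V' : zmodType).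
Variables (act : R -> V -> V) (act' : R' -> V' -> V').
Variables (M : V -> Prop) (M' : V' -> Prop) (l : nat) (x : 'I_l -> R) (x' : 'I_l -> R').

(** Linearity is asked only for the signed elements of [x] that occur in the differential, so the
    two modules may live over different rings. *)
Definition coef_map (g : V -> V') := [/\ g 0 = 0,
  forall u v, M u -> M v -> g (u + v) = g u + g v,
  forall c j u, M u -> g (act ((-1) ^+ c * x j) u) = act' ((-1) ^+ c * x' j) (g u) &
  forall u, M u -> M' (g u)].

Hypotheses (M0 : M 0) (MD : forall u v, M u -> M v -> M (u + v)).
Hypothesis MZ : forall a u, M u -> M (act a u).

Lemma koszul_d_map g (phi : {set 'I_l} -> V) (S : {set 'I_l}) : coef_map g ->
  (forall j, j \in S -> M (phi (S :\ j))) ->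
  g (koszul_d act x phi S) = koszul_d act' x' (g \o phi) S.
Proof.
move=> [g0 gD gZ _] Mphi.
suff: M (koszul_d act x phi S) /\
      g (koszul_d act x phi S) = koszul_d act' x' (g \o phi) S by case.
apply: (big_ind2 (fun u v => M u /\ g u = v)) => //.
  by move=> u v u2 v2 [Mu <-] [Mu2 <-]; split; [apply: MD|apply: gD].
by move=> j /Mphi Mj; split; [apply: MZ|apply: gZ].
Qed.
End Coefficients.

Section DirectSum.
Variables (A B : comNzRingType) (f : {rmorphism A -> B}) (J : ideal B).
Local Notation D := (dup f J).
Local Notation io := (Defs.iota f J).

Lemma iota_is_zmod_morphism : zmod_morphism io.
Proof. by move=> x y; apply: val_inj; congr pair; rewrite /= rmorphB. Qed.

Lemma iota_is_monoid_morphism : monoid_morphism io.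
Proof.
split=> [|x y]; apply: val_inj; congr pair; first exact: rmorph1.
exact: rmorphM.
Qed.

HB.instance Definition _ := GRing.isZmodMorphism.Build A D io iota_is_zmod_morphism.
HB.instance Definition _ := GRing.isMonoidMorphism.Build A D io iota_is_monoid_morphism.

Definition pr1 (z : D) : A := (\val z).1.
Definition prJ (z : D) : B := (\val z).2 - f (\val z).1.
(** Outside [J] the value defaults to 0, hence the laws of [inJ] assume membership. *)
Definition inJ (b : B) : D := insubd (0 : D) (0, b).

Lemma prJP z : J (prJ z).
Proof. by have /asboolP := valP z. Qed.

Lemma dup_eqP z w : pr1 z = pr1 w -> prJ z = prJ w -> z = w.
Proof.
rewrite /pr1 /prJ => E E'; apply: val_inj.
rewrite [LHS]surjective_pairing [RHS]surjective_pairing; congr pair => //.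
by rewrite -(subrK (f (\val z).1) (\val z).2) E' E subrK.
Qed.

Lemma pr1D z w : pr1 (z + w) = pr1 z + pr1 w. Proof. by []. Qed.
Lemma pr1M z w : pr1 (z * w) = pr1 z * pr1 w. Proof. by []. Qed.
Lemma prJD z w : prJ (z + w) = prJ z + prJ w.
Proof. by rewrite /prJ /= rmorphD opprD addrACA. Qed.
Lemma prJ_iota x : prJ (io x) = 0. Proof. exact: subrr. Qed.
Lemma prJ_iotaM x z : prJ (io x * z) = f x * prJ z.
Proof. by rewrite /prJ /= rmorphM mulrBr. Qed.

Lemma val_inJ b : J b -> \val (inJ b) = (0, b).
Proof.
by move=> Jb; apply: insubdK; apply/asboolP; rewrite /= rmorph0 subr0.
Qed.

Lemma pr1_inJ b : J b -> pr1 (inJ b) = 0. Proof. by rewrite /pr1 => /val_inJ ->. Qed.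
Lemma prJ_inJ b : J b -> prJ (inJ b) = b.
Proof. by rewrite /prJ => /val_inJ ->; rewrite rmorph0 subr0. Qed.

Lemma dup_split z : z = io (pr1 z) + inJ (prJ z).
Proof.
have Jz := prJP z; apply: dup_eqP; first by rewrite pr1D pr1_inJ // addr0.
by rewrite prJD prJ_inJ // prJ_iota add0r.
Qed.

Local Notation actJ := (fun (r : A) (v : B) => f r * v).
Local Notation all := (fun=> True).
Variables (l : nat) (x : 'I_l -> A).

Lemma signed_iota c j : (-1) ^+ c * io (x j) = io ((-1) ^+ c * x j).
Proof. by rewrite rmorphM rmorphXn rmorphN1. Qed.

Lemma coef_pr1 : coef_map *%R *%R all all (io \o x) x pr1.
Proof. by split=> // c j u _ /=; rewrite signed_iota. Qed.

Lemma coef_prJ : coef_map *%R actJ all J (io \o x) x prJ.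
Proof.
split=> [|u v _ _|c j u _|u _]; last exact: prJP.
- by rewrite /prJ /= rmorph0 subr0.
- exact: prJD.
- by rewrite /= signed_iota prJ_iotaM.
Qed.

Lemma coef_iota : coef_map *%R *%R all all x (io \o x) io.
Proof.
split=> // [|u v _ _|c j u _]; first exact: rmorph0.
  exact: rmorphD.
by rewrite /= signed_iota rmorphM.
Qed.

Lemma coef_inJ : coef_map actJ *%R J all x (io \o x) inJ.
Proof.
have [J0 JD JM] := ideal_isI J; split=> // [|u v Ju Jv|c j u Ju].
- by apply: dup_eqP; rewrite ?pr1_inJ ?prJ_inJ // /prJ /= rmorph0 subr0.
- have Juv := JD _ _ Ju Jv; apply: dup_eqP; rewrite ?pr1D ?prJD ?pr1_inJ ?prJ_inJ //.
  by rewrite addr0.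
- rewrite /= signed_iota; set r := _ * x j; have Jru := JM (f r) _ Ju.
  apply: dup_eqP; first by rewrite pr1M !pr1_inJ // mulr0.
  by rewrite prJ_iotaM !prJ_inJ.
Qed.

End DirectSum.

Section Transfer.
Variables (R R' : comNzRingType) (V V' : zmodType).
Variables (act : R -> V -> V) (act' : R' -> V' -> V').
Variables (M : V -> Prop) (M' : V' -> Prop) (l : nat) (x : 'I_l -> R) (x' : 'I_l -> R').
Hypotheses (M0 : M 0) (MD : forall u v, M u -> M v -> M (u + v)).
Hypothesis MZ : forall a u, M u -> M (act a u).
Variable g : V -> V'.
Hypothesis gmap : coef_map act act' M M' x x' g.

Lemma card_setD1_eq (S : {set 'I_l}) i j : #|S| = i.+1 -> j \in S -> #|S :\ j| = i.
Proof. by move=> sS jS; apply/eqP; rewrite -eqSS -sS (cardsD1 j S) jS. Qed.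

Lemma koszul_d_cochain i phi (S : {set 'I_l}) : kcochain M i phi -> #|S| = i.+1 ->
  g (koszul_d act x phi S) = koszul_d act' x' (g \o phi) S.
Proof.
move=> c sS; apply: (koszul_d_map M0 MD MZ gmap) => j jS.
by apply: c; apply: card_setD1_eq jS.
Qed.

Lemma kcochain_map i phi : kcochain M i phi -> kcochain M' i (g \o phi : {set 'I_l} -> V').
Proof. by case: gmap => _ _ _ gM c S /c /gM. Qed.

Lemma kcocycle_map i phi : kcochain M i phi -> kcocycle act x i phi ->
  kcocycle act' x' i (g \o phi).
Proof.
move=> c z S sS; rewrite -(koszul_d_cochain c sS) z //.
by case: gmap.
Qed.

Lemma kcoboundary_map i phi : kcoboundary act M x i phi -> kcoboundary act' M' x' i (g \o phi).
Proof.
case: i => [|i] /=; first by move=> z S /z /= ->; case: gmap.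
move=> [psi [c E]]; exists (g \o psi); split; first exact: kcochain_map.
by move=> S sS; rewrite -(koszul_d_cochain c sS) E.
Qed.
End Transfer.

Section DirectSumVanish.
Variables (A B : comNzRingType) (f : {rmorphism A -> B}) (J : ideal B).
Local Notation D := (dup f J).
Local Notation io := (Defs.iota f J).
Local Notation actJ := (fun (r : A) (v : B) => f r * v).
Local Notation all := (fun=> True).
Variables (l : nat) (x : 'I_l -> A) (i : nat).

Let J0 : J 0. Proof. by case: (ideal_isI J). Qed.
Let JD : forall u v, J u -> J v -> J (u + v). Proof. by case: (ideal_isI J). Qed.
Let JZ : forall r u, J u -> J (actJ r u).
Proof. by case: (ideal_isI J) => _ _ hM r u; apply: hM. Qed.

(** The maps [pr1], [prJ], [io] and [inJ] split the coefficients. Vanishing on a summand follows by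
    including and projecting back, vanishing on the sum by adding two primitives. *)
Lemma kvanish_dup : kvanish *%R (fun _ : D => True) (io \o x) i <->
  kvanish *%R (fun _ : A => True) x i /\ kvanish actJ J x i.
Proof.
have m1 := coef_pr1 f J x; have m2 := coef_prJ f J x.
have e1 := coef_iota f J x; have e2 := coef_inJ f J x.
split=> [van|[vA vJ] phi c z].
  split=> phi c z.
    exact: (kcoboundary_map I (fun _ _ _ _ => I) (fun _ _ _ => I) m1 (van _
      (kcochain_map e1 c) (kcocycle_map I (fun _ _ _ _ => I) (fun _ _ _ => I) e1 c z))).
  have := kcoboundary_map I (fun _ _ _ _ => I) (fun _ _ _ => I) m2 (van _
      (kcochain_map e2 c) (kcocycle_map J0 JD JZ e2 c z)).
  case: i c {z van} => [|k] c /=.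
    by move=> E S sS; rewrite -(E S sS) /= prJ_inJ //; apply: c.
  by case=> psi [c' E]; exists psi; split=> // S sS; rewrite E //= prJ_inJ //; apply: c.
have b1 := vA _ (kcochain_map m1 c) (kcocycle_map I (fun _ _ _ _ => I) (fun _ _ _ => I) m1 c z).
have b2 := vJ _ (kcochain_map m2 c) (kcocycle_map I (fun _ _ _ _ => I) (fun _ _ _ => I) m2 c z).
case: i c z b1 b2 => [|k] c z /=.
  move=> b1 b2 S sS; apply: dup_eqP; first exact: b1.
  by rewrite (b2 S sS); case: m2.
move=> [psi1 [c1 E1]] [psi2 [c2 E2]]; exists (fun S => io (psi1 S) + inJ f J (psi2 S)); split=> // S sS.
rewrite [RHS]dup_split -[pr1 _]E1 // -[prJ _]E2 //.
rewrite (koszul_d_cochain I (fun _ _ _ _ => I) (fun _ _ _ => I) e1 c1 sS).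
rewrite (koszul_d_cochain J0 JD JZ e2 c2 sS).
rewrite /koszul_d -big_split /=; apply: eq_bigr => j _; exact: mulrDr.
Qed.
End DirectSumVanish.

Lemma kgrade_gens_dup (A B : comNzRingType) (f : {rmorphism A -> B}) (J : ideal B) l
    (x : 'I_l -> A) n :
  ele (Fin n.+1) (kgrade_gens *%R (fun _ : dup f J => True) (Defs.iota f J \o x)) <->
  ele (Fin n.+1) (kgrade_gens *%R (fun _ : A => True) x) /\
  ele (Fin n.+1) (kgrade_gens (fun (r : A) (v : B) => f r * v) J x).
Proof.
split=> [/kgrade_gens_ge van|[/kgrade_gens_ge vA /kgrade_gens_ge vJ]].
  by split; apply/kgrade_gens_ge => i /van /kvanish_dup[].
by apply/kgrade_gens_ge => i le_in; apply/kvanish_dup; split; [apply: vA|apply: vJ].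
Qed.

(** * Heights under going-down and integral maps *)

Section RestrictScalars.
Variables (A B : comNzRingType) (f : {rmorphism A -> B}).

(* [f] is recorded in the type so that the scalar action can be inferred from it. *)
Definition restrict : Type := let _ := f in B.
HB.instance Definition _ := GRing.Zmodule.on restrict.

Definition restrict_scale (r : A) (v : restrict) : restrict := f r * (v : B).

Lemma restrict_scaleA a b v : restrict_scale a (restrict_scale b v) = restrict_scale (a * b) v.
Proof. by rewrite /restrict_scale rmorphM mulrA. Qed.
Lemma restrict_scale1 : left_id 1 restrict_scale.
Proof. by move=> v; rewrite /restrict_scale rmorph1 mul1r. Qed.
Lemma restrict_scaleDr : right_distributive restrict_scale +%R.
Proof. by move=> r u v; apply: mulrDr. Qed.
Lemma restrict_scaleDl v : {morph restrict_scale^~ v : a b / a + b}.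
Proof. by move=> a b; rewrite /restrict_scale rmorphD; apply: mulrDl. Qed.

HB.instance Definition _ := GRing.Zmodule_isLmodule.Build A restrict
  restrict_scaleA restrict_scale1 restrict_scaleDr restrict_scaleDl.
End RestrictScalars.

Section Heights.
Variables (A B : comNzRingType) (g : {rmorphism A -> B}).

Lemma preim_prime Q : is_prime Q -> is_prime (fun x => Q (g x)).
Proof.
move=> [[Q0 QD QM] Q1 QP]; split; [split| |].
- by rewrite rmorph0.
- by move=> x y Qx Qy; rewrite rmorphD; apply: QD.
- by move=> r x Qx; rewrite rmorphM; apply: QM.
- by rewrite rmorph1.
- by move=> x y; rewrite rmorphM => /QP.
Qed.

Lemma preim_ideal Q : is_ideal Q -> is_ideal (fun x => Q (g x)).
Proof.
move=> [Q0 QD QM]; split.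
- by rewrite rmorph0.
- by move=> x y Qx Qy; rewrite rmorphD; apply: QD.
- by move=> r x Qx; rewrite rmorphM; apply: QM.
Qed.

(** The largest prime of the chain is lifted below [Q] first, then the rest below that lift. *)
Lemma going_down_chain n (c : nat -> A -> Prop) Q : going_down g -> is_prime Q ->
    (forall k, (k <= n)%N -> is_prime (c k)) ->
    (forall k, (k < n)%N -> psubset (c k) (c k.+1)) -> (forall x, c n x -> Q (g x)) ->
  exists d : nat -> B -> Prop, [/\ forall k, (k <= n)%N -> is_prime (d k),
    forall k, (k <= n)%N -> forall x, d k (g x) <-> c k x,
    forall k, (k < n)%N -> forall y, d k y -> d k.+1 y & forall y, d n y -> Q y].
Proof.
move=> gd; elim: n c Q => [|n IH] c Q pQ pc cc cQ;
    have [Q' [pQ' Q'Q cQ']] := gd _ _ (preim_prime pQ) (pc _ (leqnn _)) cQ Q pQ (fun x => iff_refl _).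
  by exists (fun=> Q'); split=> // -[].
have [|k kn|k kn|x cx|d [pd dc dd dQ]] := IH c Q' => //.
- by apply: pc; apply: leqW.
- by apply: cc; apply: leqW.
- by apply/cQ'; apply: (proj1 (cc n (leqnn _))).
exists (fun k => if (k <= n)%N then d k else Q'); split.
- by move=> k _; case: leqP => // /pd.
- move=> k kn x; case: leqP => [/dc //|nk].
  by have -> : k = n.+1 by apply/eqP; rewrite eqn_leq kn.
- move=> k; rewrite ltnS => kn y; rewrite kn; case: leqP => [nk|lt_kn]; last exact: dd.
  have -> : k = n by apply/eqP; rewrite eqn_leq kn.
  exact: dQ.
- by move=> y; rewrite ltnn; apply: Q'Q.
Qed.

Lemma going_down_height (a : A -> Prop) (b : B -> Prop) : going_down g ->
  (forall x, a x -> b (g x)) -> ele (height a) (height b).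
Proof.
move=> gd ab; apply: (proj2 (einfP _)) => _ [Q [pQ bQ ->]].
apply: (ele_trans (proj1 (einfP _) (dim_loc (fun x => Q (g x))) _)).
  by exists (fun x => Q (g x)); split=> //; [exact: preim_prime|move=> x /ab /bQ].
apply: (proj2 (esupP _)) => _ [n [-> [c [pc cc cQ]]]].
have [d [pd dc dd dQ]] := going_down_chain gd pQ pc cc cQ.
apply: (proj1 (esupP _)); exists n; split=> //; exists d; split=> // k kn.
(* Strictness is inherited from the contractions, which are the members of [c]. *)
split; first exact: dd.
have [_ [x [c1 c2]]] := cc k kn; exists (g x); split; first by apply/dc.
by move/(dc _ (ltnW kn)).
Qed.

Hypothesis integral : forall z, exists p : {poly A}, p \is monic /\ root (map_poly g p) z.

(** If the contractions agreed, a monic equation of some [z] in [P2] outside [P1] would have its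
    constant term in [P1]; so [z] cancels modulo [P1] and the degree drops until 1 lies in [P1]. *)
Lemma incomparable P1 P2 : is_prime P1 -> is_prime P2 -> psubset P1 P2 ->
  psubset (fun x => P1 (g x)) (fun x => P2 (g x)).
Proof.
move=> [[P10 P1D P1M] P11 P1P] [i2 P21 _] [s12 [z [P2z P1z]]].
split=> [x|]; first exact: s12.
apply: contrapT => none.
have P12 x : P2 (g x) -> P1 (g x) by move=> h; apply: contrapT => h'; apply: none; exists x.
have [p [pm /rootP pz]] := integral z.
have: P1 (map_poly g p).[z] by rewrite pz.
elim/poly_ind: p pm {pz} => [|q c IH] pm.
  by move: pm; rewrite monicE lead_coef0 eq_sym oner_eq0.
rewrite rmorphD rmorphM /= map_polyX map_polyC /= hornerD hornerMX hornerC => h.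
have hc : P1 (g c).
  apply: P12; apply: (idealBl i2 (y := - ((map_poly g q).[z] * z))).
    by rewrite opprK addrC; apply: s12.
  by apply: idealN => //; case: i2 => _ _ hM; apply: hM.
have [/eqP q0|qn0] := boolP (q == 0).
  move: pm hc; rewrite q0 mul0r add0r monicE lead_coefC => /eqP ->.
  by rewrite rmorph1.
have {}h : P1 ((map_poly g q).[z] * z) by rewrite -(addrK (g c) (_ * z)); apply: idealB.
case: (P1P _ _ h) => //; apply: IH.
move: pm; rewrite !monicE lead_coefDl ?lead_coefMX // size_polyC.
by rewrite size_mulX //; case: (c == 0); rewrite //= ltnS size_poly_gt0.
Qed.

(** [P] is chosen maximal over [I] missing the image of the complement of [p]. Were [x] in [p] with
    [g x] outside [P], then [g s] would equal [r * g x] modulo [P] for some [s] outside [p], and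
    integrality of [r] would put a power of [s] in [p]. *)
Lemma lying_over (I : B -> Prop) (p : A -> Prop) : is_ideal I -> is_prime p ->
  (forall x, I (g x) -> p x) ->
  exists P, [/\ is_prime P, forall z, I z -> P z & forall x, P (g x) <-> p x].
Proof.
move=> hI pp Ip; have [[p0 pD pM] p1 pP] := pp.
pose S z := exists2 s, ~ p s & z = g s.
have [||z w|z Iz|P [pP' IP disP out]] := @prime_disjoint _ I S.
- exact: hI.
- by exists 1 => //; rewrite rmorph1.
- by move=> [s ps ->] [t pt ->]; exists (s * t); [case/pP|rewrite rmorphM].
- by move=> [s ps zs]; apply: ps; apply: Ip; rewrite -zs.
have [iP P1 PM] := pP'; have [P0 PD PMl] := iP.
have Pp x : P (g x) -> p x.
  by move=> Px; apply: contrapT => px; apply: (disP _ Px); exists x.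
exists P; split=> // x; split; first exact: Pp.
move=> px; apply: contrapT => /out[q [r [Pq [s ps E]]]].
have Esr : P (g s - r * g x) by rewrite -E addrK.
(* Homogenized equation: multiplying by [g x ^+ n] turns powers of [r] into powers of [g s], and
   every term below degree [n] keeps a factor [x]. *)
have key n (c : {poly A}) : (size c <= n.+1)%N ->
    exists t, P (g (c`_n * s ^+ n + x * t) - g x ^+ n * (map_poly g c).[r]).
  elim/poly_ind: c n => [|d c IH] n.
    by exists 0; rewrite coef0 mul0r add0r mulr0 !rmorph0 horner0 mulr0 subr0.
  rewrite rmorphD rmorphM /= map_polyX map_polyC /= hornerD hornerMX hornerC.
  rewrite coefD coefMX coefC.
  case: n => [|n] sz.
    have d0 : d = 0.
      apply/eqP; rewrite -size_poly_eq0.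
      by move: sz; rewrite size_MXaddC; case: ifP => [/andP[/eqP-> _ _]|_]; rewrite ?size_poly0 ?ltnS ?leqn0.
    exists 0; rewrite d0 rmorph0 horner0 mul0r !add0r !expr0 !mul1r mulr1 mulr0 addr0.
    by rewrite subrr.
  have [|t Pt] := IH n.
    move: sz; rewrite size_MXaddC; case: ifP => // /andP[/eqP-> _] _.
    by rewrite size_poly0.
  exists (t * s + x ^+ n * c); rewrite /= addr0.
  have -> : g (d`_n * s ^+ n.+1 + x * (t * s + x ^+ n * c)) -
      g x ^+ n.+1 * ((map_poly g d).[r] * r + g c) =
    g s * (g (d`_n * s ^+ n + x * t) - g x ^+ n * (map_poly g d).[r])
    + (g x ^+ n * (map_poly g d).[r]) * (g s - r * g x).
    by rewrite !exprS !(rmorphD, rmorphM, rmorphXn); ring.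
  by apply: (PD); apply: PMl.
have [c [cm /rootP cr]] := integral r.
have sc : (0 < size c)%N by rewrite size_poly_gt0 monic_neq0.
have [|t] := key (size c).-1 c; first by rewrite prednK.
rewrite cr mulr0 subr0 -[c`__]/(lead_coef c) (monicP cm) mul1r => /Pp pst.
apply/ps/(primeX pp (n := (size c).-1))/(idealBl (y := - (x * t))); first by case: pp.
  by rewrite opprK.
by apply: idealN; [case: pp|rewrite mulrC; apply: pM].
Qed.

(** Lying over lifts a prime over the contraction to one over [I], and chains below the lift stay
    strict on contraction by incomparability. *)
Lemma integral_height (I : B -> Prop) : is_ideal I ->
  ele (height I) (height (fun x => I (g x))).
Proof.
move=> hI; apply: (proj2 (einfP _)) => _ [p [pp Ip ->]].
have [P [pP IP Pp]] := lying_over hI pp Ip.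
apply: (ele_trans (proj1 (einfP _) (dim_loc P) _)); first by exists P.
apply: (proj2 (esupP _)) => _ [n [-> [c [pc cc cP]]]].
apply: (proj1 (esupP _)); exists n; split=> //; exists (fun k x => c k (g x)); split.
- by move=> k /pc; apply: preim_prime.
- by move=> k kn; apply: incomparable (cc k kn); apply: pc => //; apply: ltnW.
- by move=> x /cP /Pp.
Qed.
End Heights.

(** * The amalgamation *)

Section Amalgamation.
Variables (A B : comNzRingType) (f : {rmorphism A -> B}) (J : ideal B).
Local Notation D := (dup f J).
Local Notation io := (Defs.iota f J).
Implicit Types (a : A -> Prop) (I : D -> Prop).

Lemma ext_iota a x : a x -> ext f J a (io x).
Proof. by move=> ax; exists 1%N, (fun=> 1), (fun=> x); rewrite big_ord1 mul1r. Qed.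

(** If [Q] contains the copy of [J], then [p'] is pulled back along [pr1]. Otherwise some (0, j)
    avoids [Q], so [Q] comes from a prime of [B], to which going-down for [f] applies. *)
Lemma going_down_iota : going_down f -> going_down io.
Proof.
move=> gd p p' pp pp' p'p Q pQ Qp; have [[Q0 QD QM] Q1 QP] := pQ.
have [[p'0 p'D p'M] p'1 p'P] := pp'.
have [sub|] := pselect (forall b, J b -> Q (inJ f J b)).
  exists (fun z => p' (pr1 z)); split; last by [].
    split; [split|exact: p'1|by move=> z w; apply: p'P] => //.
    - by move=> z w; apply: p'D.
    - by move=> r z; apply: p'M.
  move=> z /p'p /Qp Qz; rewrite [z]dup_split; apply: QD => //.
  exact/sub/prJP.
move=> /existsNP[j /not_implyP[Jj Qj]].
have JM b : J (j * b) by rewrite mulrC; case: (ideal_isI J) => _ _ hM; apply: hM.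
have [_ JD _] := ideal_isI J.
have inJM b (z : D) : inJ f J (j * b) * z = inJ f J (j * (b * (\val z).2)).
  apply: val_inj; rewrite [RHS]val_inJ // -[LHS]/(\val _ * \val z) val_inJ //.
  exact: (congr2 pair (mul0r (\val z).1) (esym (mulrA j b (\val z).2))).
have Qbar (z : D) : Q (inJ f J (j * (\val z).2)) <-> Q z.
  have E : inJ f J (j * (\val z).2) = inJ f J j * z.
    by have := inJM 1 z; rewrite mulr1 mul1r.
  by rewrite E; split=> [/QP[/Qj//|//]|Qz]; apply: QM.
(* the prime of [B] contracting to [Q] *)
pose q b := Q (inJ f J (j * b)).
have pq : is_prime q.
  split; [split| |] => [|b b' qb qb'|r b qb||b b' qbb]; rewrite /q.
  - have -> : inJ f J (j * 0) = 0 by apply: val_inj; rewrite mulr0 val_inJ //; case: (ideal_isI J).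
    exact: Q0.
  - have -> : inJ f J (j * (b + b')) = inJ f J (j * b) + inJ f J (j * b').
      apply: val_inj; rewrite [LHS]val_inJ // -[RHS]/(\val _ + \val _) !val_inJ //.
      exact: (congr2 pair (esym (addr0 0)) (mulrDr j b b')).
    exact: QD.
  - have E : inJ f J (j * (r * b)) * inJ f J j = inJ f J (j * r) * inJ f J (j * b).
      by rewrite !inJM !val_inJ //=; congr inJ; ring.
    have : Q (inJ f J (j * (r * b)) * inJ f J j) by rewrite E; apply: QM.
    by case/QP => // /Qj.
  - by rewrite mulr1.
  - apply: QP; have -> : inJ f J (j * b) * inJ f J (j * b') = inJ f J (j * (b * b')) * inJ f J j.
      by rewrite !inJM !val_inJ //=; congr inJ; ring.
    by rewrite mulrC; apply: QM.
have [q' [pq' q'q q'p']] := gd p p' pp pp' p'p q pq (fun x => iff_trans (Qbar (io x)) (Qp x)).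
exists (fun z => q' (\val z).2); split; last exact: q'p'.
  have [[q'0 q'D q'M] q'1 q'P] := pq'; split; [split|exact: q'1|by move=> z w; apply: q'P] => //.
  - by move=> z w; apply: q'D.
  - by move=> r z; apply: q'M.
by move=> z /q'q /Qbar.
Qed.

(** Finitely many elements of the extension involve finitely many elements of [a]; membership in the
    ideal these generate is phrased by testing all ideals. *)
Lemma ext_finite a (y : seq D) : (forall z, z \in y -> ext f J a z) ->
  exists s : seq A, (forall x, x \in s -> a x) /\
    forall z, z \in y -> forall I, is_ideal I -> (forall x, x \in s -> I (io x)) -> I z.
Proof.
elim: y => [|z y IH] ay; first by exists [::].
have [|s [as_ sy]] := IH; first by move=> w wy; apply: ay; rewrite inE wy orbT.
have [n [r [x [ax ->]]]] := ay z (mem_head _ _).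
exists ([seq x k | k <- enum 'I_n] ++ s); split=> [u|w].
  by rewrite mem_cat => /orP[/mapP[k _ ->]|/as_].
rewrite inE => /orP[/eqP-> I [I0 ID IM] Is|wy I hI Is]; last first.
  by apply: (sy _ wy I hI) => u us; apply: Is; rewrite mem_cat us orbT.
elim/big_ind: _ => // k _; apply: (IM); apply: Is.
by rewrite mem_cat; apply/orP; left; apply/mapP; exists k; rewrite ?mem_enum.
Qed.

Local Notation kgD := (kgrade_gens *%R (fun _ : D => True)).
Local Notation kgJ := (kgrade_gens (fun (r : A) (v : B) => f r * v) J).

Lemma kgrade_gens_self_le (R : comNzRingType) l m (x : 'I_l -> R) (y : 'I_m -> R) :
  (forall j (I : R -> Prop), is_ideal I -> (forall k, I (x k)) -> I (y j)) ->
  ele (kgrade_gens *%R (fun _ : R => True) y) (kgrade_gens *%R (fun _ : R => True) x).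
Proof. exact: (@kgrade_gens_le R R^o (fun=> True) I (fun _ _ _ _ _ => I)). Qed.

Lemma kgrade_gens_J_le l m (x : 'I_l -> A) (y : 'I_m -> A) :
  (forall j (I : A -> Prop), is_ideal I -> (forall k, I (x k)) -> I (y j)) ->
  ele (kgJ y) (kgJ x).
Proof.
have [J0 JD JM] := ideal_isI J.
apply: (@kgrade_gens_le A (restrict f) J) => // r u v Ju Jv.
by apply: JD => //; apply: JM.
Qed.

(** Elements of the extension can be replaced by images of elements of [a] without lowering the
    grade, and the complex of these images splits. *)
Lemma kgrade_ext_le a :
  ele (kgrade_self (ext f J a)) (kgrade_self a) /\
  ele (kgrade_self (ext f J a)) (kgrade_J f J a).
Proof.
suff h l (y : 'I_l -> D) : (forall j, ext f J a (y j)) ->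
    ele (kgD y) (kgrade_self a) /\ ele (kgD y) (kgrade_J f J a).
  by split; apply: (proj2 (esupP _)) => _ [l [y [/h[h1 h2] ->]]].
elim/tuple_seq: l / y => y ay.
have [|s [as_ sy]] := @ext_finite a y.
  by move=> z /(nthP 0)[j jy <-]; apply: ay (Ordinal jy).
pose x := fun k : 'I_(size s) => s`_k.
have ax k : a (x k) by apply/as_/mem_nth.
have yx : ele (kgD (fun j : 'I_(size y) => y`_j)) (kgD (io \o x)).
  apply: kgrade_gens_self_le => j I hI Ix; apply: (sy y`_j) => //; first exact: mem_nth.
  by move=> u /(nthP 0)[k ks <-]; apply: Ix (Ordinal ks).
split; apply: ele_trans yx _; apply: ele_trans (kgrade_ge _ _ ax);
  by apply: ele_of_Fin => n /kgrade_gens_dup[].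
Qed.

Lemma kgrade_contraction_ge I a : (forall x, a x -> I (io x)) -> forall e,
  ele e (kgrade_self a) -> ele e (kgrade_J f J a) -> ele e (kgrade_self I).
Proof.
move=> aI e eA eJ; apply: ele_of_Fin => n ne.
have /esup_Fin_lt[_ [l [x [ax ->]]] nx] := ele_trans ne eA.
have /esup_Fin_lt[_ [m [y [ay ->]]] ny] := ele_trans ne eJ.
(* The bounds for [A] and for [J] may come from different sequences; by monotonicity their
   concatenation serves both. *)
pose z (k : 'I_(l + m)) := match split k with inl j => x j | inr j => y j end.
have zx (K : A -> Prop) : (forall k, K (z k)) -> (forall j, K (x j)) /\ (forall j, K (y j)).
  by move=> Kz; split=> j; [have := Kz (unsplit (inl j)) | have := Kz (unsplit (inr j))];
    rewrite /z unsplitK.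
have az k : I ((io \o z) k) by apply: aI; rewrite /z; case: (split k).
apply: ele_trans (kgrade_ge _ _ az); apply/kgrade_gens_dup; split.
  by apply: (ele_trans nx); apply: kgrade_gens_self_le => j K _ /zx[].
by apply: (ele_trans ny); apply: kgrade_gens_J_le => j K _ /zx[].
Qed.
End Amalgamation.

Theorem theorem4p11 (A B : comNzRingType) (f : {rmorphism A -> B}) (J : ideal B) :
  (* (1) *)
  (forall CA : (A -> Prop) -> Prop,
     (forall a, CA a -> is_ideal a) ->
     (exists a, CA a) ->
     going_down f ->
     CM_in (fun I : dup f J -> Prop => exists a, CA a /\ I = ext f J a) ->
     CM_in CA /\ (forall a, CA a -> ele (height a) (kgrade_J f J a)))
  /\
  (* (2) *)
  (iota_integral_ext f J ->
   CM_in (@is_ideal A) ->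
   (forall a : A -> Prop, is_ideal a -> ele (height a) (kgrade_J f J a)) ->
   CM_in (@is_ideal (dup f J))).
Proof.
split=> [CA _ _ gd CMD|[_ int] CMA htJ I hI].
  have ht a : CA a -> ele (height a) (kgrade_self (ext f J a)).
    move=> Ca; rewrite -CMD; last by exists a.
    exact: going_down_height (going_down_iota gd) (@ext_iota _ _ f J a).
  split=> a Ca; have [leA leJ] := kgrade_ext_le f J a.
    by apply: ele_anti (kgrade_le_height _); apply: ele_trans leA; apply: ht.
  by apply: ele_trans leJ; apply: ht.
apply: ele_anti (kgrade_le_height _).
apply: ele_trans (integral_height int hI) _.
have ha := preim_ideal (Defs.iota f J) hI.
apply: (kgrade_contraction_ge (a := fun x => I (Defs.iota f J x))) => //; last exact: htJ.
by rewrite -CMA //; apply: ele_refl.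
Qed.
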